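(* Let $(M,g)$ be a $Co(QE)_4$ spacetime satisfying Einstein's field equation and whose space-matter tensor $P$ is divergence free. Then the energy density $\sigma$ is constant.
   Context: A $Co(QE)_4$ spacetime is a non-flat connected $4$-dimensional Lorentzian manifold $(M,g)$, signature $(-,+,+,+)$, whose Ricci tensor $S$ is non-zero and satisfies $$S(X,Y)=a\,g(X,Y)+\sum_{i,j=1}^4 b_{ij}\,\omega^i(X)\omega^j(Y)+c_1d_1(X,Y)+c_2d_2(X,Y)$$ for all $X,Y$, where $a,b_{ij}=b_{ji},c_1,c_2$ are scalars (functions), $\omega^1,\dots,\omega^4$ are non-zero $1$-forms, $g(X,W_i)=\omega^i(X)$ with $W_1,\dots,W_4$ mutually orthogonal unit vector fields ($g(W_i,W_i)=\pm1$), and $d_1,d_2$ are symmetric trace-free $(0,2)$-tensors with $d_1(X,W_1)=d_2(X,W_1)=0$ for all $X$. Einstein's field equation is $S-\frac r2 g+\Lambda g=\kappa T$, where $r$ is the scalar curvature, $\Lambda$ the cosmological constant, $\kappa$ the gravitational constant and $T$ the $(0,2)$ energy-momentum tensor. The space-matter tensor is the $(0,4)$-tensor $$P=R+\frac{\kappa}{2}\,g\wedge T-\sigma G,$$ where $\sigma$ is the energy density (a function on $M$), $G(X,Y,Z,W)=g(Y,Z)g(X,W)-g(X,Z)g(Y,W)$, and $$(\alpha\wedge\beta)(X,Y,Z,W)=\alpha(Y,Z)\beta(X,W)+\alpha(X,W)\beta(Y,Z)-\alpha(X,Z)\beta(Y,W)-\alpha(Y,W)\beta(X,Z).$$ Here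 $R$ is the curvature tensor with $S(Y,Z)=\operatorname{tr}_g R(\cdot,Y,Z,\cdot)$. The divergence of a $(0,4)$-tensor is taken on the last slot: $(\operatorname{div}P)(X,Y,Z)=\operatorname{tr}_g\,(\nabla_{\cdot}P)(X,Y,Z,\cdot)$, so that $(\operatorname{div}R)(X,Y,Z)=(\nabla_XS)(Y,Z)-(\nabla_YS)(X,Z)$. ''Divergence free'' means $\operatorname{div}P=0$. *)

(* Defs.v *)
From HB Require Import structures.
From mathcomp Require Import all_boot all_order all_algebra.
From mathcomp Require Import all_classical all_reals all_analysis.

Set Implicit Arguments.
Unset Strict Implicit.
Unset Printing Implicit Defensive.

Import Order.TTheory GRing.Theory Num.Theory.
Import numFieldNormedType.Exports.

Local Open Scope classical_set_scope.
Local Open Scope ring_scope.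

Definition partial (R : realType) (n : nat) (i : 'I_n)
    (f : 'rV[R]_n -> R) (x : 'rV[R]_n) : R :=
  'D_(delta_mx 0 i) f x.

(* The predicates below are only meant for an open set U. *)
Fixpoint Ck (R : realType) (n k : nat) (U : set 'rV[R]_n)
    (f : 'rV[R]_n -> R) : Prop :=
  (forall x, U x -> {for x, continuous f}) /\
  match k with
  | 0%N => True
  | k'.+1 => forall i : 'I_n,
      (forall x, U x -> derivable f x (delta_mx 0 i)) /\
      Ck k' U (partial i f)
  end.

Definition smooth_on (R : realType) (n : nat) (U : set 'rV[R]_n)
    (f : 'rV[R]_n -> R) : Prop :=
  forall k, Ck k U f.

(* The manifold is Hausdorff, second countable and given by a smooth atlas; the
   functions [coord c] and [param c] are total and only meaningful on
   [dom c] and on its image respectively. *)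
Record smooth_manifold (R : realType) (n : nat) (M : topologicalType) :=
  SmoothManifold {
  chart : Type;
  dom : chart -> set M;
  coord : chart -> M -> 'rV[R]_n;
  param : chart -> 'rV[R]_n -> M;
  manifold_hausdorff : hausdorff_space M;
  manifold_second_countable : @second_countable M;
  dom_cover : forall p, exists c, dom c p;
  dom_open : forall c, open (dom c);
  image_open : forall c, open (coord c @` dom c);
  coordK : forall c p, dom c p -> param c (coord c p) = p;
  coord_continuous : forall c p, dom c p -> {for p, continuous (coord c)};
  param_continuous : forall c x, (coord c @` dom c) x ->
    {for x, continuous (param c)};
  transition_smooth : forall c c' (k : 'I_n),
    smooth_on (coord c @` (dom c `&` dom c'))
              (fun x => coord c' (param c x) 0 k)
}.

Definition smooth_in (R : realType) (n : nat) (M : topologicalType)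
    (A : smooth_manifold R n M) (c : chart A) (f : M -> R) : Prop :=
  smooth_on (coord c @` dom c) (f \o param c).

Definition smooth_scalar (R : realType) (n : nat) (M : topologicalType)
    (A : smooth_manifold R n M) (f : M -> R) : Prop :=
  forall c : chart A, smooth_in c f.

Definition pd (R : realType) (n : nat) (M : topologicalType)
    (A : smooth_manifold R n M) (c : chart A) (i : 'I_n)
    (f : M -> R) (p : M) : R :=
  partial i (f \o param c) (coord c p).

(* Entry (i, k) is the derivative of the k-th coordinate of c' with respect
   to the i-th coordinate of c. *)
Definition jac (R : realType) (n : nat) (M : topologicalType)
    (A : smooth_manifold R n M) (c c' : chart A) (p : M) : 'M[R]_n :=
  \matrix_(i, k) pd c i (fun q => coord c' q 0 k) p.

(* Tensor fields are given by their components in the coordinate frame of every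
   chart, which have to be smooth and to obey the transformation law. *)
Record vector_field (R : realType) (n : nat) (M : topologicalType)
    (A : smooth_manifold R n M) := VectorField {
  vf_comp :> chart A -> M -> 'rV[R]_n;
  vf_trans : forall c c' p, dom c p -> dom c' p -> forall k,
    vf_comp c' p 0 k = \sum_i vf_comp c p 0 i * jac c c' p i k;
  vf_smooth : forall c k, smooth_in c (fun p => vf_comp c p 0 k)
}.

Record one_form (R : realType) (n : nat) (M : topologicalType)
    (A : smooth_manifold R n M) := OneForm {
  of_comp :> chart A -> M -> 'rV[R]_n;
  of_trans : forall c c' p, dom c p -> dom c' p -> forall i,
    of_comp c p 0 i = \sum_k jac c c' p i k * of_comp c' p 0 k;
  of_smooth : forall c i, smooth_in c (fun p => of_comp c p 0 i)
}.

Record tensor2 (R : realType) (n : nat) (M : topologicalType)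
    (A : smooth_manifold R n M) := Tensor2 {
  t2_comp :> chart A -> M -> 'M[R]_n;
  t2_trans : forall c c' p, dom c p -> dom c' p -> forall i j,
    t2_comp c p i j =
      \sum_k \sum_l jac c c' p i k * jac c c' p j l * t2_comp c' p k l;
  t2_smooth : forall c i j, smooth_in c (fun p => t2_comp c p i j)
}.

(* Evaluation at one point, on tangent vectors given by their components. *)
Definition ev1 (R : realType) (n : nat) (w X : 'rV[R]_n) : R :=
  \sum_i w 0 i * X 0 i.

Definition ev2 (R : realType) (n : nat) (B : 'M[R]_n) (X Y : 'rV[R]_n) : R :=
  \sum_i \sum_j B i j * X 0 i * Y 0 j.

Definition symmetric_tensor (R : realType) (n : nat) (M : topologicalType)
    (A : smooth_manifold R n M) (B : tensor2 A) : Prop :=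
  forall c p, dom c p -> forall X Y, ev2 (B c p) X Y = ev2 (B c p) Y X.

Definition minkowski (R : realType) (n : nat) : 'M[R]_n.+1 :=
  diag_mx (\row_i (if i == ord0 then -1 else 1)).

(* The rows of E form a frame of the tangent space at p in which the metric is
   diag (-1, 1, ..., 1). *)
Record lorentz_metric (R : realType) (n : nat) (M : topologicalType)
    (A : smooth_manifold R n.+1 M) := LorentzMetric {
  metric :> tensor2 A;
  metric_sym : symmetric_tensor metric;
  metric_signature : forall c p, dom c p ->
    exists2 E : 'M[R]_n.+1, E \in unitmx
      & E *m metric c p *m E^T = minkowski R n
}.

Section Curvature.

Context (R : realType) (n : nat) (M : topologicalType)
  (A : smooth_manifold R n.+1 M) (g : lorentz_metric A).

Implicit Types (c : chart A) (p : M) (i j k l m s : 'I_n.+1).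

Definition inv_metric c p : 'M[R]_n.+1 := invmx (g c p).

Definition trace2 c p (B : 'M[R]_n.+1) : R :=
  \sum_i \sum_j inv_metric c p i j * B i j.

(* The coefficient of e_k in the Levi-Civita derivative of e_j along e_i. *)
Definition christoffel c p k i j : R :=
  2^-1 * \sum_l inv_metric c p k l *
    (pd c i (fun q => g c q j l) p + pd c j (fun q => g c q i l) p
     - pd c l (fun q => g c q i j) p).

(* The coefficient of e_l in R(e_i, e_j) e_k, where
   R(X, Y) = [nabla_X, nabla_Y] - nabla_[X, Y]. *)
Definition curvature_op c p l i j k : R :=
  pd c i (fun q => christoffel c q l j k) p
  - pd c j (fun q => christoffel c q l i k) p
  + \sum_m (christoffel c p m j k * christoffel c p l i m
            - christoffel c p m i k * christoffel c p l j m).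

(* R(X, Y, Z, W) = g(R(X, Y) Z, W) on (e_i, e_j, e_k, e_l). *)
Definition riemann c p i j k l : R :=
  \sum_m curvature_op c p m i j k * g c p m l.

(* S(Y, Z) is the trace of R(., Y, Z, .). *)
Definition ricci c p : 'M[R]_n.+1 :=
  \matrix_(j, k) trace2 c p (\matrix_(i, l) riemann c p i j k l).

Definition scalar_curvature c p : R := trace2 c p (ricci c p).

(* The component on (e_i, e_j, e_k, e_l) of the covariant derivative along e_m
   of the (0,4)-tensor field with components Q. *)
Definition cov_deriv4 c
    (Q : M -> 'I_n.+1 -> 'I_n.+1 -> 'I_n.+1 -> 'I_n.+1 -> R)
    p m i j k l : R :=
  pd c m (fun q => Q q i j k l) p
  - \sum_s (christoffel c p s m i * Q p s j k l
            + christoffel c p s m j * Q p i s k l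
            + christoffel c p s m k * Q p i j s l
            + christoffel c p s m l * Q p i j k s).

Definition div4 c
    (Q : M -> 'I_n.+1 -> 'I_n.+1 -> 'I_n.+1 -> 'I_n.+1 -> R) p i j k : R :=
  trace2 c p (\matrix_(m, l) cov_deriv4 c Q p m i j k l).

Definition wedge (a b : 'M[R]_n.+1) i j k l : R :=
  a j k * b i l + a i l * b j k - a i k * b j l - a j l * b i k.

Definition Gtensor c p i j k l : R :=
  g c p j k * g c p i l - g c p i k * g c p j l.

Definition flat_metric : Prop :=
  forall c p, dom c p -> forall i j k l, riemann c p i j k l = 0.

Definition ricci_zero : Prop := forall c p, dom c p -> ricci c p = 0.

Definition einstein_equation (Lambda kappa : R) (T : tensor2 A) : Prop :=
  forall c p, dom c p ->
    ricci c p - (scalar_curvature c p / 2) *: g c p + Lambda *: g c p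
    = kappa *: T c p.

Definition space_matter (kappa : R) (T : tensor2 A) (sigma : M -> R)
    c p i j k l : R :=
  riemann c p i j k l + kappa / 2 * wedge (g c p) (T c p) i j k l
  - sigma p * Gtensor c p i j k l.

Definition space_matter_div_free (kappa : R) (T : tensor2 A)
    (sigma : M -> R) : Prop :=
  forall c p, dom c p -> forall i j k,
    div4 c (space_matter kappa T sigma c) p i j k = 0.

End Curvature.

(* The indices 1, ..., 4 are 'I_4, so that W_1 is [W ord0]. *)
Definition is_CoQE4_spacetime (R : realType) (M : topologicalType)
    (A : smooth_manifold R 4 M) (g : lorentz_metric A) : Prop :=
  connected [set: M] /\
  ~ flat_metric g /\
  ~ ricci_zero g /\
  exists (a : M -> R) (b : 'I_4 -> 'I_4 -> M -> R) (c1 c2 : M -> R)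
         (omega : 'I_4 -> one_form A) (W : 'I_4 -> vector_field A)
         (d1 d2 : tensor2 A),
    [/\ smooth_scalar A a, forall i j, smooth_scalar A (b i j),
        smooth_scalar A c1 & smooth_scalar A c2] /\
    (forall i j p, b i j p = b j i p) /\
    (forall i, exists c p, dom c p /\ omega i c p != 0) /\
    (forall i c p, dom c p -> forall X,
       ev2 (g c p) X (W i c p) = ev1 (omega i c p) X) /\
    (forall i c p, dom c p ->
       ev2 (g c p) (W i c p) (W i c p) = 1 \/
       ev2 (g c p) (W i c p) (W i c p) = -1) /\
    (forall i j, i != j -> forall c p, dom c p ->
       ev2 (g c p) (W i c p) (W j c p) = 0) /\
    [/\ symmetric_tensor d1, symmetric_tensor d2,
        forall c p, dom c p -> trace2 g c p (d1 c p) = 0 &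
        forall c p, dom c p -> trace2 g c p (d2 c p) = 0] /\
    (forall c p, dom c p -> forall X,
       ev2 (d1 c p) X (W ord0 c p) = 0 /\ ev2 (d2 c p) X (W ord0 c p) = 0) /\
    (forall c p, dom c p -> forall X Y,
       ev2 (ricci g c p) X Y =
         a p * ev2 (g c p) X Y
         + \sum_i \sum_j b i j p * ev1 (omega i c p) X * ev1 (omega j c p) Y
         + c1 p * ev2 (d1 c p) X Y + c2 p * ev2 (d2 c p) X Y).

(* Main.v *)
(* Einstein's equation turns the space-matter tensor into
     P = R + (1/2) g /\ S - (r/2 - Lambda + sigma) G.
   In dimension 4 its trace over the two middle slots is
     2 S + (3 Lambda - r - 3 sigma) g.
   Contractions commute with the Levi-Civita derivative, so div P = 0 gives
   2 div S - dr - 3 dsigma = 0, while the second Bianchi identity gives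
   2 div S = dr. Hence dsigma = 0, and M is connected. *)

Require Import Defs.
From mathcomp Require Import all_boot all_order all_algebra.
From mathcomp Require Import all_classical all_reals all_analysis.
From mathcomp Require Import ring lra.
(* [coord] would otherwise denote the coordinates of a vector in a basis. *)
Import Defs.

Set Implicit Arguments.
Unset Strict Implicit.
Unset Printing Implicit Defensive.

Import Order.TTheory GRing.Theory Num.Theory.
Import numFieldNormedType.Exports.

Local Open Scope classical_set_scope.
Local Open Scope ring_scope.

(** * Directional derivatives *)

(** Tensors are known only through their components in charts, so the obstacle is the index
    bookkeeping in the Bianchi identity and in the commutation of traces with the covariant
    derivative. Two indices are therefore packed into a matrix wherever possible: the connection
    along [e_i] is a matrix, and metric compatibility and curvature are matrix equations. The two
    facts about curvature that need second derivatives, skew symmetry in the last two slots and the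
    second Bianchi identity, become polynomial identities between non-commuting matrices. Their
    analytic input is the product rule and the equality of mixed partial derivatives, which is
    derived from the mean value theorem. The middle slots are the natural ones to contract: [P] is
    skew in its first two slots, hence so is [div P]. Its trace over those two vanishes, and its two
    other traces agree up to sign. *)

Section DirectionalDerivatives.

Context (R : realType) (V : normedModType R).
Implicit Types (f : V -> R) (u v x y : V).

Lemma is_derive_line f x v (s : R) : derivable f (x + s *: v) v ->
  is_derive s 1 (fun t : R => f (x + t *: v)) ('D_v f (x + s *: v)).
Proof.
have E : (fun h : R => h^-1 *: (f (x + (h *: (1 : R) + s) *: v)
            - f (x + s *: v)))
  = (fun h : R => h^-1 *: (f (h *: v + (x + s *: v)) - f (x + s *: v))).
  apply/funext => h; congr (_ *: (f _ - _)).
  by rewrite [h *: 1]mulr1 scalerDl addrCA.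
move=> df; apply: DeriveDef.
  by rewrite /derivable /= E.
by rewrite /derive /= E.
Qed.

Lemma mean_value_line f x v (a : R) : 0 < a ->
  (forall s : R, 0 <= s <= a -> derivable f (x + s *: v) v) ->
  exists2 s : R, 0 < s < a & f (x + a *: v) - f x = a * 'D_v f (x + s *: v).
Proof.
move=> a0 df.
have [||s sa] := @MVT R (fun t => f (x + t *: v))
    (fun t => 'D_v f (x + t *: v)) 0 a a0.
- move=> s; rewrite in_itv/= => /andP[s0 sa].
  by apply: is_derive_line; apply: df; rewrite !ltW.
- apply: derivable_within_continuous => s; rewrite in_itv/= => sa.
  by have [] := is_derive_line (df s sa).
- rewrite scale0r addr0 subr0 mulrC => e; exists s => //.
Qed.

(** The left side of the final equation is symmetric in [u] and [v], the right side is not: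
    comparing both orders yields the equality of mixed derivatives. The mean value theorem is used
    for [F] along [u] and for ['D_u f] along [v]. *)
Lemma second_difference f x u v (a : R) : 0 < a ->
  (forall s t : R, 0 <= s <= a -> 0 <= t <= a ->
    derivable f (x + s *: u + t *: v) u /\
    derivable ('D_u f) (x + s *: u + t *: v) v) ->
  exists s t, [/\ 0 < s < a, 0 < t < a &
    f (x + a *: u + a *: v) - f (x + a *: u) - f (x + a *: v) + f x =
    a * a * 'D_v ('D_u f) (x + s *: u + t *: v)].
Proof.
move=> a0 H.
have aa : 0 <= a <= a by rewrite lexx ltW.
have a00 : (0 : R) <= 0 <= a by rewrite lexx ltW.
pose F y := f (y + a *: v) - f y.
have dF s : 0 <= s <= a -> is_derive (x + s *: u) u F
    ('D_u f (x + s *: u + a *: v) - 'D_u f (x + s *: u)).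
  move=> sa; have [d1 _] := H s a sa aa; have [d0 _] := H s 0 sa a00.
  rewrite scale0r addr0 in d0.
  apply: is_deriveB; last exact/derivableP.
  have E : (fun h : R => h^-1 *: (f (h *: u + (x + s *: u) + a *: v)
            - f (x + s *: u + a *: v)))
   = (fun h : R => h^-1 *: (f (h *: u + (x + s *: u + a *: v))
            - f (x + s *: u + a *: v))).
    by apply/funext => h; congr (_ *: (f _ - _)); rewrite -[LHS]addrA.
  by apply: DeriveDef; rewrite /derivable /derive /= E.
have [|s sa e1] := @mean_value_line F x u a a0.
  by move=> s sa; have [] := dF s sa.
have sa' : 0 <= s <= a by case/andP: sa => *; rewrite !ltW.
have [|t ta e2] := @mean_value_line ('D_u f) (x + s *: u) v a a0.
  by move=> t ta; have [] := H s t sa' ta.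
exists s, t; split=> //.
have -> : f (x + a *: u + a *: v) - f (x + a *: u) - f (x + a *: v) + f x
   = F (x + a *: u) - F x by rewrite /F; ring.
have [_ e3] := dF s sa'.
by rewrite e1 e3 e2 mulrA.
Qed.

(** Both mixed derivatives, each at some point of a small parallelogram at [x], equal the same
    second difference divided by [a * a]; continuity at [x] brings the two points together. *)
Lemma derive_comm f x u v (U : set V) : open U -> U x ->
  (forall y, U y -> derivable f y u /\ derivable f y v) ->
  (forall y, U y -> derivable ('D_u f) y v /\ derivable ('D_v f) y u) ->
  {for x, continuous ('D_v ('D_u f))} -> {for x, continuous ('D_u ('D_v f))} ->
  'D_v ('D_u f) x = 'D_u ('D_v f) x.
Proof.
move=> oU Ux d1 d2 c1 c2; apply/eqP; rewrite -subr_eq0 -normr_le0.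
apply/ler_addgt0Pr => e e0; rewrite add0r.
have e2 : 0 < e / 2 by rewrite divr_gt0.
have : \forall y \near x, [/\ U y,
   `|'D_v ('D_u f) x - 'D_v ('D_u f) y| < e / 2 &
   `|'D_u ('D_v f) x - 'D_u ('D_v f) y| < e / 2].
  have N0 : \forall y \near x, U y by exact: open_nbhs_nbhs.
  have N1 : \forall y \near x, `|'D_v ('D_u f) x - 'D_v ('D_u f) y| < e / 2.
    by move/cvgrPdist_lt: c1; apply.
  have N2 : \forall y \near x, `|'D_u ('D_v f) x - 'D_u ('D_v f) y| < e / 2.
    by move/cvgrPdist_lt: c2; apply.
  by apply: filterS3 N0 N1 N2.
case/nbhs_ballP => r /= r0 Hr.
(* The step [a] is chosen so that the whole parallelogram fits in the ball; the summand 1 keeps the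
   denominator positive when [u] and [v] are zero. *)
have D0 : 0 < `|u| + `|v| + 1 by rewrite ltr_wpDl // addr_ge0.
have [a a0 aD] : exists2 a : R, 0 < a & a * (`|u| + `|v| + 1) = r / 2.
  exists (r / 2 / (`|u| + `|v| + 1)); first by rewrite !divr_gt0.
  by rewrite divfK // gt_eqF.
have Hb s t : 0 <= s <= a -> 0 <= t <= a -> ball x r (x + s *: u + t *: v).
  move=> /andP[s0 sa] /andP[t0 ta].
  rewrite -ball_normE /= -addrA opprD addNKr normrN.
  apply: le_lt_trans (_ : r / 2 < r); last first.
    by rewrite ltr_pdivrMr // ltr_pMr // ltr1n.
  rewrite (le_trans (ler_normD _ _)) // !normrZ !ger0_norm // -aD.
  rewrite !mulrDr mulr1 -[leLHS]addr0 !lerD // ?ler_wpM2r // ltW //.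
have [|s [t [sa ta es]]] := @second_difference f x u v a a0.
  move=> s t sa ta; have [Uy _ _] := Hr _ (Hb s t sa ta).
  exact: conj (d1 _ Uy).1 (d2 _ Uy).1.
have [|t' [s' [ta' sa' es']]] := @second_difference f x v u a a0.
  move=> t1 s1 ta1 sa1; have [Uy _ _] := Hr _ (Hb _ _ sa1 ta1); rewrite addrAC.
  exact: conj (d1 _ Uy).2 (d2 _ Uy).2.
have W w : 0 < w < a -> 0 <= w <= a by move=> /andP[*]; rewrite !ltW.
have [_ b1 _] := Hr _ (Hb _ _ (W _ sa) (W _ ta)).
have [_ _ b2] := Hr _ (Hb _ _ (W _ sa') (W _ ta')).
have swap s1 t1 : x + s1 *: v + t1 *: u = x + t1 *: u + s1 *: v.
  exact: addrAC.
rewrite !swap in es'.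
have e12 : 'D_v ('D_u f) (x + s *: u + t *: v)
   = 'D_u ('D_v f) (x + s' *: u + t' *: v).
  have cancel (B C D E k X Y : R) : k != 0 ->
    B - C - D + E = k * X -> B - D - C + E = k * Y -> X = Y.
    by move=> k0; rewrite (addrAC B) => -> /(mulfI k0).
  by apply: cancel es es'; rewrite mulf_neq0 // gt_eqF.
rewrite -e12 distrC in b2.
apply: le_trans (ler_distD ('D_v ('D_u f) (x + s *: u + t *: v)) _ _) _.
rewrite [leRHS](splitr e); exact: lerD (ltW b1) (ltW b2).
Qed.

End DirectionalDerivatives.

(** * Smooth functions on an open set *)

Section SmoothOn.

Context (R : realType) (n : nat) (U : set 'rV[R]_n) (oU : open U).
Implicit Types (f g : 'rV[R]_n -> R) (x : 'rV[R]_n) (i j : 'I_n) (k : nat).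

(** Values outside [U] are meaningless. As [U] is open, agreement on it is agreement of germs,
    through which continuity and derivatives transfer. *)
Lemma near_open_eq f g x : (forall y, U y -> f y = g y) -> U x ->
  \forall y \near x, f y = g y.
Proof.
by move=> fg Ux; apply: filterS (open_nbhs_nbhs (conj oU Ux)) => y /fg.
Qed.

Lemma partial_ext f g x i : (forall y, U y -> f y = g y) -> U x ->
  partial i f x = partial i g x.
Proof. by move=> fg Ux; apply: near_eq_derive; apply: near_open_eq. Qed.

Lemma continuous_open_ext f g x : (forall y, U y -> f y = g y) -> U x ->
  {for x, continuous f} -> {for x, continuous g}.
Proof.
move=> fg Ux; rewrite /prop_for /continuous_at -(fg _ Ux) => cf.
exact: cvg_trans (near_eq_cvg (near_open_eq fg Ux)) cf.
Qed.

Lemma Ck_ext k f g : (forall y, U y -> f y = g y) -> Ck k U f -> Ck k U g.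
Proof.
elim: k f g => [|k IH] f g fg [cf H]; (split;
  first by move=> x Ux; apply: continuous_open_ext fg Ux (cf x Ux)) => // i.
have [df Cf] := H i; split=> [x Ux|].
  exact: near_eq_derivable (near_open_eq fg Ux) (df x Ux).
by apply: IH Cf => y Uy; apply: partial_ext.
Qed.

Lemma Ck_continuous k f x : Ck k U f -> U x -> {for x, continuous f}.
Proof. by case: k => [|k] [cf _] Ux; apply: cf. Qed.

Lemma CkW k f : Ck k.+1 U f -> Ck k U f.
Proof.
elim: k f => [|k IH] f [cf H]; first by [].
by split=> // i; have [df Cf] := H i; split=> //; apply: IH.
Qed.

Lemma Ck_cst k (a : R) : Ck k U (cst a).
Proof.
elim: k a => [|k IH] a; (split; first by move=> x _; exact: cst_continuous) => // i.
split=> [x _|]; first exact: derivable_cst.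
by apply: Ck_ext (IH 0) => y _; rewrite /partial derive_cst.
Qed.

Lemma CkD k f g : Ck k U f -> Ck k U g -> Ck k U (f \+ g).
Proof.
elim: k f g => [|k IH] f g [cf Hf] [cg Hg]; (split;
  first by move=> x Ux; exact: continuousD (cf x Ux) (cg x Ux)) => // i.
have [df Cf] := Hf i; have [dg Cg] := Hg i; split=> [x Ux|].
  exact: derivableD (df x Ux) (dg x Ux).
apply: Ck_ext (IH _ _ Cf Cg) => y Uy.
exact: esym (deriveD (df y Uy) (dg y Uy)).
Qed.

Lemma CkM k f g : Ck k U f -> Ck k U g -> Ck k U (f \* g).
Proof.
elim: k f g => [|k IH] f g CKf CKg; (split;
  first by move=> x Ux; 
    exact: continuousM (Ck_continuous CKf Ux) (Ck_continuous CKg Ux)) => // i.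
have [df Cf] := CKf.2 i; have [dg Cg] := CKg.2 i.
split=> [x Ux|]; first exact: derivableM (df x Ux) (dg x Ux).
apply: Ck_ext (CkD (IH _ _ (CkW CKf) Cg) (IH _ _ (CkW CKg) Cf)) => y Uy.
exact: esym (deriveM (df y Uy) (dg y Uy)).
Qed.

Lemma CkV k f : (forall x, U x -> f x != 0) -> Ck k U f ->
  Ck k U (fun x => (f x)^-1).
Proof.
move=> f0; elim: k => [|k IH] CKf; (split;
  first by move=> x Ux; 
    exact: continuousV (f0 x Ux) (Ck_continuous CKf Ux)) => // i.
have [df Cf] := CKf.2 i.
split=> [x Ux|]; first exact: derivableV (f0 x Ux) (df x Ux).
have IH' := IH (CkW CKf).
(* The derivative of [1/f] is [-(1/f)^2 f'], so the induction hypothesis on [1/f] itself bounds its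
   regularity from below. *)
apply: Ck_ext (CkM (Ck_cst k (-1)) (CkM (CkM IH' IH') Cf)) => y Uy.
rewrite /partial (deriveV (f0 y Uy) (df y Uy)) /= mulN1r expr2 invfM.
by rewrite scaleNr.
Qed.

Lemma smooth_on_ext f g : (forall y, U y -> f y = g y) ->
  smooth_on U f -> smooth_on U g.
Proof. by move=> fg Sf k; apply: Ck_ext (Sf k). Qed.

Lemma smooth_on_derivable f x i : smooth_on U f -> U x ->
  derivable f x (delta_mx 0 i).
Proof. by move=> Sf Ux; exact: ((Sf 1).2 i).1. Qed.

Lemma smooth_on_partial f i : smooth_on U f -> smooth_on U (partial i f).
Proof. by move=> Sf k; exact: ((Sf k.+1).2 i).2. Qed.

Lemma partial_comm f x i j : smooth_on U f -> U x ->
  partial i (partial j f) x = partial j (partial i f) x.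
Proof.
move=> Sf Ux.
apply: (@derive_comm _ _ f x (delta_mx 0 j) (delta_mx 0 i) U oU Ux)
  => [y Uy|y Uy||].
- exact: conj (smooth_on_derivable Sf Uy) (smooth_on_derivable Sf Uy).
- exact: conj (smooth_on_derivable (smooth_on_partial j Sf) Uy)
    (smooth_on_derivable (smooth_on_partial i Sf) Uy).
- exact: Ck_continuous (smooth_on_partial i (smooth_on_partial j Sf) 0%N) Ux.
- exact: Ck_continuous (smooth_on_partial j (smooth_on_partial i Sf) 0%N) Ux.
Qed.

End SmoothOn.

(** * Calculus in a chart *)

Section ChartCalculus.

Context (R : realType) (n : nat) (M : topologicalType)
  (A : smooth_manifold R n M) (c : chart A).
Implicit Types (f g : M -> R) (p : M) (i j : 'I_n).

Let U := coord c @` dom c.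

Let oU : open U. Proof. exact: image_open. Qed.

Lemma image_coord p : dom c p -> (coord c @` dom c) (coord c p).
Proof. by move=> cp; exists p. Qed.

Lemma param_dom x : (coord c @` dom c) x -> dom c (param c x).
Proof. by move=> [p cp <-]; rewrite coordK. Qed.

Lemma paramK x : (coord c @` dom c) x -> coord c (param c x) = x.
Proof. by move=> [p cp <-]; rewrite coordK. Qed.

Lemma smooth_in_ext f g : (forall p, dom c p -> f p = g p) ->
  smooth_in c f -> smooth_in c g.
Proof.
move=> fg; apply: smooth_on_ext => //.
by move=> x Ux /=; apply: fg; apply: param_dom.
Qed.

Lemma smooth_in_cst (a : R) : smooth_in c (fun=> a).
Proof. by move=> k; apply: Ck_cst. Qed.

Lemma smooth_inD f g : smooth_in c f -> smooth_in c g ->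
  smooth_in c (fun q => f q + g q).
Proof. by move=> Sf Sg k; apply: CkD (Sf k) (Sg k). Qed.

Lemma smooth_inM f g : smooth_in c f -> smooth_in c g ->
  smooth_in c (fun q => f q * g q).
Proof. by move=> Sf Sg k; apply: CkM (Sf k) (Sg k). Qed.

Lemma smooth_inN f : smooth_in c f -> smooth_in c (fun q => - f q).
Proof.
move=> Sf; apply: smooth_in_ext (smooth_inM (smooth_in_cst (-1)) Sf) => p _.
by rewrite mulN1r.
Qed.

Lemma smooth_inB f g : smooth_in c f -> smooth_in c g ->
  smooth_in c (fun q => f q - g q).
Proof. by move=> Sf Sg; apply: smooth_inD => //; apply: smooth_inN. Qed.

Lemma smooth_inV f : (forall p, dom c p -> f p != 0) -> smooth_in c f ->
  smooth_in c (fun q => (f q)^-1).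
Proof.
move=> f0 Sf k; apply: (CkV oU _ (Sf k)) => x Ux /=.
by apply: f0; apply: param_dom.
Qed.

Lemma smooth_in_sum (I : Type) (r : seq I) (P : pred I) (F : I -> M -> R) :
  (forall a, smooth_in c (F a)) ->
  smooth_in c (fun q => \sum_(a <- r | P a) F a q).
Proof.
move=> SF; elim: r => [|a r IH].
  by apply: smooth_in_ext (smooth_in_cst 0) => p _; rewrite big_nil.
case Pa : (P a); last by apply: smooth_in_ext IH => p _; rewrite big_cons Pa.
by apply: smooth_in_ext (smooth_inD (SF a) IH) => p _; rewrite big_cons Pa.
Qed.

Lemma smooth_in_prod (I : Type) (r : seq I) (P : pred I) (F : I -> M -> R) :
  (forall a, smooth_in c (F a)) ->
  smooth_in c (fun q => \prod_(a <- r | P a) F a q).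
Proof.
move=> SF; elim: r => [|a r IH].
  by apply: smooth_in_ext (smooth_in_cst 1) => p _; rewrite big_nil.
case Pa : (P a); last by apply: smooth_in_ext IH => p _; rewrite big_cons Pa.
by apply: smooth_in_ext (smooth_inM (SF a) IH) => p _; rewrite big_cons Pa.
Qed.

Lemma smooth_in_pd f i : smooth_in c f -> smooth_in c (pd c i f).
Proof.
move=> Sf; apply: smooth_on_ext (smooth_on_partial i Sf) => // x Ux /=.
by rewrite /pd paramK.
Qed.

Lemma pd_ext f g p i : (forall q, dom c q -> f q = g q) -> dom c p ->
  pd c i f p = pd c i g p.
Proof.
move=> fg cp; apply: (partial_ext oU) (image_coord cp) => x Ux /=.
by apply: fg; apply: param_dom.
Qed.

Lemma smooth_in_derivable f p i : smooth_in c f -> dom c p ->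
  derivable (f \o param c) (coord c p) (delta_mx 0 i).
Proof. by move=> Sf cp; apply: smooth_on_derivable Sf (image_coord cp). Qed.

Lemma pd_cst (a : R) p i : pd c i (fun=> a) p = 0.
Proof. exact: derive_cst. Qed.

Lemma pdD f g p i : smooth_in c f -> smooth_in c g -> dom c p ->
  pd c i (fun q => f q + g q) p = pd c i f p + pd c i g p.
Proof.
move=> Sf Sg cp.
exact: deriveD (@smooth_in_derivable _ p i Sf cp) (@smooth_in_derivable _ p i Sg cp).
Qed.

Lemma pdM f g p i : smooth_in c f -> smooth_in c g -> dom c p ->
  pd c i (fun q => f q * g q) p = pd c i f p * g p + f p * pd c i g p.
Proof.
move=> Sf Sg cp.
have /= := deriveM (@smooth_in_derivable _ p i Sf cp)
  (@smooth_in_derivable _ p i Sg cp).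
by rewrite coordK // addrC [g p *: _]mulrC => {1}<-.
Qed.

Lemma pdZ (a : R) f p i : smooth_in c f -> dom c p ->
  pd c i (fun q => a * f q) p = a * pd c i f p.
Proof.
move=> Sf cp; have := pdM i (smooth_in_cst a) Sf cp.
by rewrite pd_cst mul0r add0r.
Qed.

Lemma pdN f p i : smooth_in c f -> dom c p ->
  pd c i (fun q => - f q) p = - pd c i f p.
Proof.
move=> Sf cp; rewrite -[RHS]mulN1r -pdZ //.
by apply: pd_ext => // q _; rewrite mulN1r.
Qed.

Lemma pdB f g p i : smooth_in c f -> smooth_in c g -> dom c p ->
  pd c i (fun q => f q - g q) p = pd c i f p - pd c i g p.
Proof. by move=> Sf Sg cp; rewrite -pdN // -pdD //; apply: smooth_inN. Qed.

Lemma pd_sum (I : Type) (r : seq I) (P : pred I) (F : I -> M -> R) p i :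
  (forall a, smooth_in c (F a)) -> dom c p ->
  pd c i (fun q => \sum_(a <- r | P a) F a q) p
  = \sum_(a <- r | P a) pd c i (F a) p.
Proof.
move=> SF cp; elim: r => [|a r IH].
  rewrite big_nil; apply: etrans (pd_cst 0 p i).
  by apply: pd_ext => // q _; rewrite big_nil.
rewrite big_cons -IH; case Pa : (P a).
  rewrite -pdD //; last exact: smooth_in_sum.
  by apply: pd_ext => // q _; rewrite big_cons Pa.
by apply: pd_ext => // q _; rewrite big_cons Pa.
Qed.

Lemma pd_comm f p i j : smooth_in c f -> dom c p ->
  pd c i (pd c j f) p = pd c j (pd c i f) p.
Proof.
move=> Sf cp.
have E k l : pd c k (pd c l f) p
    = partial k (partial l (f \o param c)) (coord c p).
  apply: (partial_ext oU) (image_coord cp) => x Ux /=.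
  by rewrite /pd paramK.
by rewrite !E (partial_comm oU _ _ Sf (image_coord cp)).
Qed.

(** * Matrix-valued functions in a chart *)

Definition smooth_mx m1 m2 (F : M -> 'M[R]_(m1, m2)) : Prop :=
  forall a b, smooth_in c (fun q => F q a b).

Definition pd_mx m1 m2 i (F : M -> 'M[R]_(m1, m2)) p : 'M[R]_(m1, m2) :=
  \matrix_(a, b) pd c i (fun q => F q a b) p.

Lemma smooth_mx_ext m1 m2 (F G : M -> 'M[R]_(m1, m2)) :
  (forall p, dom c p -> F p = G p) -> smooth_mx F -> smooth_mx G.
Proof.
by move=> FG SF a b; apply: smooth_in_ext (SF a b) => p cp; rewrite FG.
Qed.

Lemma smooth_mxD m1 m2 (F G : M -> 'M[R]_(m1, m2)) :
  smooth_mx F -> smooth_mx G -> smooth_mx (fun q => F q + G q).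
Proof.
move=> SF SG a b; apply: smooth_in_ext (smooth_inD (SF a b) (SG a b)) => p _.
by rewrite mxE.
Qed.

Lemma smooth_mxN m1 m2 (F : M -> 'M[R]_(m1, m2)) :
  smooth_mx F -> smooth_mx (fun q => - F q).
Proof.
by move=> SF a b; apply: smooth_in_ext (smooth_inN (SF a b)) => p _; rewrite mxE.
Qed.

Lemma smooth_mxB m1 m2 (F G : M -> 'M[R]_(m1, m2)) :
  smooth_mx F -> smooth_mx G -> smooth_mx (fun q => F q - G q).
Proof. by move=> SF SG; apply: smooth_mxD => //; apply: smooth_mxN. Qed.

Lemma smooth_mxM m1 m2 m3 (F : M -> 'M[R]_(m1, m2)) (G : M -> 'M[R]_(m2, m3)) :
  smooth_mx F -> smooth_mx G -> smooth_mx (fun q => F q *m G q).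
Proof.
move=> SF SG a b.
have S : smooth_in c (fun q => \sum_k F q a k * G q k b).
  by apply: smooth_in_sum => k; apply: smooth_inM.
by apply: smooth_in_ext S => p _; rewrite mxE.
Qed.

Lemma smooth_mxT m1 m2 (F : M -> 'M[R]_(m1, m2)) :
  smooth_mx F -> smooth_mx (fun q => (F q)^T).
Proof. by move=> SF a b; apply: smooth_in_ext (SF b a) => p _; rewrite mxE. Qed.

Lemma smooth_pd_mx m1 m2 i (F : M -> 'M[R]_(m1, m2)) :
  smooth_mx F -> smooth_mx (pd_mx i F).
Proof.
move=> SF a b; apply: smooth_in_ext (smooth_in_pd i (SF a b)) => p _.
by rewrite mxE.
Qed.

Lemma smooth_det m (F : M -> 'M[R]_m) :
  smooth_mx F -> smooth_in c (fun q => \det (F q)).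
Proof.
move=> SF; apply: smooth_in_sum => s; apply: smooth_inM => //.
  exact: smooth_in_cst.
by apply: smooth_in_prod.
Qed.

(** Cramer's rule: the entries of the adjugate are signed minors, and the determinant has no zero on
    the domain. *)
Lemma smooth_invmx m (F : M -> 'M[R]_m) :
  (forall p, dom c p -> F p \in unitmx) ->
  smooth_mx F -> smooth_mx (fun q => invmx (F q)).
Proof.
move=> uF SF a b.
have D0 p : dom c p -> \det (F p) != 0.
  by move/uF; rewrite unitmxE unitfE.
have Sadj : smooth_in c (fun q => \adj (F q) a b).
  have S : smooth_in c (fun q => (-1) ^+ (b + a) * \det (row' b (col' a (F q)))).
    apply: smooth_inM; first exact: smooth_in_cst.
    apply: smooth_det => a' b'.
    by apply: smooth_in_ext (SF (lift b a') (lift a b')) => p _; rewrite !mxE.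
  by apply: smooth_in_ext S => p _; rewrite mxE.
apply: smooth_in_ext (smooth_inM (smooth_inV D0 (smooth_det SF)) Sadj) => p cp.
by rewrite /invmx uF // [RHS]mxE.
Qed.

Lemma pd_mx_ext m1 m2 i (F G : M -> 'M[R]_(m1, m2)) p :
  (forall q, dom c q -> F q = G q) -> dom c p -> pd_mx i F p = pd_mx i G p.
Proof.
move=> FG cp; apply/matrixP => a b; rewrite !mxE.
by apply: pd_ext => // q /FG ->.
Qed.

Lemma pd_mx_cst m1 m2 i (B : 'M[R]_(m1, m2)) p : pd_mx i (fun=> B) p = 0.
Proof. by apply/matrixP => a b; rewrite !mxE pd_cst. Qed.

Lemma pd_mxD m1 m2 i (F G : M -> 'M[R]_(m1, m2)) p :
  smooth_mx F -> smooth_mx G -> dom c p ->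
  pd_mx i (fun q => F q + G q) p = pd_mx i F p + pd_mx i G p.
Proof.
move=> SF SG cp; apply/matrixP => a b; rewrite !mxE -pdD //.
by apply: pd_ext => // q _; rewrite mxE.
Qed.

Lemma pd_mxN m1 m2 i (F : M -> 'M[R]_(m1, m2)) p :
  smooth_mx F -> dom c p -> pd_mx i (fun q => - F q) p = - pd_mx i F p.
Proof.
move=> SF cp; apply/matrixP => a b; rewrite !mxE -pdN //.
by apply: pd_ext => // q _; rewrite mxE.
Qed.

Lemma pd_mxB m1 m2 i (F G : M -> 'M[R]_(m1, m2)) p :
  smooth_mx F -> smooth_mx G -> dom c p ->
  pd_mx i (fun q => F q - G q) p = pd_mx i F p - pd_mx i G p.
Proof.
by move=> SF SG cp; rewrite -pd_mxN // -pd_mxD //; apply: smooth_mxN.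
Qed.

Lemma pd_mxM m1 m2 m3 i (F : M -> 'M[R]_(m1, m2)) (G : M -> 'M[R]_(m2, m3)) p :
  smooth_mx F -> smooth_mx G -> dom c p ->
  pd_mx i (fun q => F q *m G q) p = pd_mx i F p *m G p + F p *m pd_mx i G p.
Proof.
move=> SF SG cp; apply/matrixP => a b; rewrite !mxE -big_split /=.
transitivity (pd c i (fun q => \sum_k F q a k * G q k b) p).
  by apply: pd_ext => // q _; rewrite mxE.
rewrite pd_sum // => [|k]; last exact: smooth_inM.
by apply: eq_bigr => k _; rewrite pdM // !mxE.
Qed.

Lemma pd_mxT m1 m2 i (F : M -> 'M[R]_(m1, m2)) p :
  dom c p -> pd_mx i (fun q => (F q)^T) p = (pd_mx i F p)^T.
Proof.
move=> cp; apply/matrixP => a b; rewrite !mxE.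
by apply: pd_ext => // q _; rewrite mxE.
Qed.

Lemma pd_mx_comm m1 m2 i j (F : M -> 'M[R]_(m1, m2)) p :
  smooth_mx F -> dom c p -> pd_mx i (pd_mx j F) p = pd_mx j (pd_mx i F) p.
Proof.
move=> SF cp; apply/matrixP => a b; rewrite [LHS]mxE [RHS]mxE.
transitivity (pd c i (pd c j (fun q => F q a b)) p).
  by apply: pd_ext => // q _; rewrite mxE.
rewrite (pd_comm _ _ (SF a b) cp); apply: pd_ext => // q _.
by rewrite [RHS]mxE.
Qed.

(** Obtained by differentiating [invmx F *m F = 1] and solving for the derivative of the inverse. *)
Lemma pd_invmx m i (F : M -> 'M[R]_m) p :
  (forall q, dom c q -> F q \in unitmx) -> smooth_mx F -> dom c p ->
  pd_mx i (fun q => invmx (F q)) p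
  = - (invmx (F p) *m pd_mx i F p *m invmx (F p)).
Proof.
move=> uF SF cp.
have := pd_mxM i (smooth_invmx uF SF) SF cp.
have -> : pd_mx i (fun q => invmx (F q) *m F q) p = 0.
  by apply: etrans (pd_mx_cst i 1%:M p); apply: pd_mx_ext => // q /uF /mulVmx.
move/esym/eqP; rewrite addr_eq0 => /eqP /(congr1 (mulmx^~ (invmx (F p)))).
by rewrite mulmxK ?uF // mulNmx.
Qed.

End ChartCalculus.

(** * The Levi-Civita connection *)

Section MatrixIdentities.

Context (R : comPzRingType) (n : nat).
Implicit Types (B C D : 'M[R]_n).

Lemma mulmx_mxE B C a b : \sum_k B a k * C k b = (B *m C) a b.
Proof. by rewrite mxE. Qed.

Lemma mxDE B C a b : (B + C) a b = B a b + C a b.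
Proof. by rewrite mxE. Qed.

Lemma mxNE B a b : (- B) a b = - B a b.
Proof. by rewrite mxE. Qed.

Lemma trmxD B C : (B + C)^T = B^T + C^T.
Proof. exact: linearD. Qed.

Lemma trmxN B : (- B)^T = - B^T.
Proof. exact: linearN. Qed.

(* [Gi], [dij] and [ddijk] stand for the connection matrices, the derivatives
   [d_i Gj] and [d_i d_j Gk], and [Cij] for the curvature, with derivative
   [DkCij]. *)
Lemma bianchi_matrix_identity (G1 G2 G3 d12 d13 d21 d23 d31 d32 : 'M[R]_n)
    (dd123 dd132 dd213 dd231 dd312 dd321 : 'M[R]_n)
    (C12 C23 C31 D3C12 D1C23 D2C31 : 'M[R]_n) :
  C12 = d12 - d21 + (G2 *m G1 - G1 *m G2) ->
  C23 = d23 - d32 + (G3 *m G2 - G2 *m G3) ->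
  C31 = d31 - d13 + (G1 *m G3 - G3 *m G1) ->
  D3C12 = dd312 - dd321
    + (d32 *m G1 + G2 *m d31 - (d31 *m G2 + G1 *m d32)) ->
  D1C23 = dd123 - dd132
    + (d13 *m G2 + G3 *m d12 - (d12 *m G3 + G2 *m d13)) ->
  D2C31 = dd231 - dd213
    + (d21 *m G3 + G1 *m d23 - (d23 *m G1 + G3 *m d21)) ->
  dd123 = dd213 -> dd132 = dd312 -> dd231 = dd321 ->
  (D3C12 + C12 *m G3 - G3 *m C12) + (D1C23 + C23 *m G1 - G1 *m C23)
  + (D2C31 + C31 *m G2 - G2 *m C31) = 0.
Proof.
move=> -> -> -> -> -> -> -> -> ->.
rewrite !(mulmxDl, mulmxDr, mulNmx, mulmxN, mulmxA).
apply/matrixP => a b; rewrite !(mxDE, mxNE) [RHS]mxE; ring.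
Qed.

(** The left side is the commutator of two derivatives of [G], once each first derivative is
    expanded as [Gi *m G + G *m Gi^T]. The right side is the curvature acting on both slots of
    [G]. *)
Lemma curvature_metric_identity (G Gi Gj dij dji : 'M[R]_n) :
  dij *m G + Gj *m (Gi *m G + G *m Gi^T)
    + ((Gi *m G + G *m Gi^T) *m Gj^T + G *m dij^T)
  - (dji *m G + Gi *m (Gj *m G + G *m Gj^T)
    + ((Gj *m G + G *m Gj^T) *m Gi^T + G *m dji^T))
  = (dij - dji + (Gj *m Gi - Gi *m Gj)) *m G
    + G *m (dij - dji + (Gj *m Gi - Gi *m Gj))^T.
Proof.
rewrite !(trmxD, trmxN, trmx_mul).
rewrite !(mulmxDl, mulmxDr, mulNmx, mulmxN, mulmxA).
apply/matrixP => a b; rewrite !(mxDE, mxNE); ring.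
Qed.

End MatrixIdentities.

(** * Metric, trace, connection and curvature in matrix form *)

Section LeviCivita.

Context (R : realType) (n : nat) (M : topologicalType)
  (A : smooth_manifold R n.+1 M) (g : lorentz_metric A) (c : chart A).
Implicit Types (p q : M) (i j k l m s : 'I_n.+1).

Local Notation H := (inv_metric g c).

Lemma metric_mx_sym p : dom c p -> (g c p)^T = g c p.
Proof.
move=> cp; apply/matrixP => i j; rewrite mxE.
have E a b : ev2 (g c p) (delta_mx 0 a) (delta_mx 0 b) = g c p a b.
  rewrite /ev2 (bigD1 a) //= (bigD1 b) //= !mxE !eqxx !mulr1.
  rewrite !big1 ?addr0 // => [a' /negPf na|b' /negPf nb].
    by apply: big1 => b' _; rewrite !mxE na mulr0 mul0r.
  by rewrite !mxE nb mulr0.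
by rewrite -!E (metric_sym g cp).
Qed.

Lemma metricC p i j : dom c p -> g c p i j = g c p j i.
Proof. by move=> cp; rewrite -{1}(metric_mx_sym cp) mxE. Qed.

(** Determinants are compared in a frame where the metric is diagonal with entries -1 and 1. *)
Lemma metric_unit p : dom c p -> g c p \in unitmx.
Proof.
move=> cp; have [E uE /(congr1 determinant)] := metric_signature g cp.
rewrite !det_mulmx det_tr det_diag unitmxE unitfE => e.
apply/eqP => g0; move: e; rewrite g0 mulr0 mul0r => /esym/eqP.
rewrite prodf_seq_eq0 => /hasP[i _]; rewrite mxE /=.
by case: ifP => _; rewrite ?oppr_eq0 oner_eq0.
Qed.

Lemma inv_metric_sym p : dom c p -> (H p)^T = H p.
Proof. by move=> cp; rewrite /inv_metric trmx_inv metric_mx_sym. Qed.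

Lemma inv_metricC p i j : dom c p -> H p i j = H p j i.
Proof. by move=> cp; rewrite -{1}(inv_metric_sym cp) mxE. Qed.

Lemma smooth_metric : smooth_mx c (g c).
Proof. by move=> i j; apply: t2_smooth. Qed.

Lemma smooth_inv_metric : smooth_mx c H.
Proof. exact: smooth_invmx metric_unit smooth_metric. Qed.

Lemma trace2E p (B : 'M[R]_n.+1) : trace2 g c p B = \tr (H p *m B^T).
Proof.
by apply: eq_bigr => i _; rewrite !mxE; apply: eq_bigr => j _; rewrite !mxE.
Qed.

Lemma trace2D p (B C : 'M[R]_n.+1) :
  trace2 g c p (B + C) = trace2 g c p B + trace2 g c p C.
Proof. by rewrite !trace2E linearD mulmxDr mxtraceD. Qed.

Lemma trace2Z p a (B : 'M[R]_n.+1) :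
  trace2 g c p (a *: B) = a * trace2 g c p B.
Proof. by rewrite !trace2E linearZ -scalemxAr mxtraceZ. Qed.

Lemma trace2N p (B : 'M[R]_n.+1) : trace2 g c p (- B) = - trace2 g c p B.
Proof. by rewrite !trace2E linearN mulmxN linearN. Qed.

Lemma trace2_0 p : trace2 g c p 0 = 0.
Proof. by rewrite -[0](scale0r 0) trace2Z mul0r. Qed.

Lemma trace2_sum (I : Type) (r : seq I) p (F : I -> 'M[R]_n.+1) :
  trace2 g c p (\sum_(s <- r) F s) = \sum_(s <- r) trace2 g c p (F s).
Proof.
elim: r => [|s r IH]; last by rewrite !big_cons trace2D IH.
by rewrite !big_nil trace2_0.
Qed.

Lemma trace2T p (B : 'M[R]_n.+1) : dom c p ->
  trace2 g c p B^T = trace2 g c p B.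
Proof.
by move=> cp; rewrite !trace2E -mxtrace_tr trmx_mul trmxK inv_metric_sym //
  mxtrace_mulC.
Qed.

Lemma trace2_metric p : dom c p -> trace2 g c p (g c p) = n.+1%:R.
Proof.
by move=> cp; rewrite trace2E metric_mx_sym // mulVmx ?metric_unit // mxtrace1.
Qed.

Lemma smooth_trace2 (F : M -> 'M[R]_n.+1) :
  smooth_mx c F -> smooth_in c (fun q => trace2 g c q (F q)).
Proof.
move=> SF; apply: smooth_in_sum => i; apply: smooth_in_sum => j.
by apply: smooth_inM => //; apply: smooth_inv_metric.
Qed.

(** Row [k] holds the components of the derivative of [e_k] along [e_i]. With this row convention,
    products of connection matrices appear in the reverse of the usual order, as in
    [curvature_mxE]. *)
Definition connection_mx i p : 'M[R]_n.+1 :=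
  \matrix_(k, l) christoffel g c p l i k.

Definition curvature_mx i j p : 'M[R]_n.+1 :=
  \matrix_(k, l) curvature_op g c p l i j k.

Local Notation Gam := connection_mx.
Local Notation Curv := curvature_mx.

Lemma christoffel_sym p k i j : dom c p ->
  christoffel g c p k i j = christoffel g c p k j i.
Proof.
move=> cp; congr (_ * _); apply: eq_bigr => l _; congr (_ * _).
rewrite [X in X - _]addrC; congr (_ - _).
by apply: pd_ext => // q cq; apply: metricC.
Qed.

Lemma connection_mxC p i j k : dom c p -> Gam i p j k = Gam j p i k.
Proof. by move=> cp; rewrite !mxE christoffel_sym. Qed.

(** The Koszul formula for the lowered connection matrix adds the skew part of this matrix to half
    the derivative of the metric. *)
Let grad i q : 'M[R]_n.+1 := \matrix_(k, l) pd c k (fun q => g c q i l) q.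

Lemma connection_mxE i p : dom c p ->
  Gam i p = 2^-1 *: ((pd_mx c i (g c) p + grad i p - (grad i p)^T) *m H p).
Proof.
move=> cp; apply/matrixP => k l; rewrite !mxE /christoffel; congr (_ * _).
apply: eq_bigr => s _; rewrite inv_metricC // mulrC; congr (_ * _).
by rewrite !mxE.
Qed.

Lemma smooth_connection i : smooth_mx c (Gam i).
Proof.
have Sg : smooth_mx c (grad i).
  move=> k l; apply: smooth_in_ext (smooth_in_pd k (smooth_metric i l)) => q _.
  by rewrite mxE.
have S : smooth_mx c
    (fun q => (pd_mx c i (g c) q + grad i q - (grad i q)^T) *m H q).
  apply: smooth_mxM smooth_inv_metric; apply: smooth_mxB (smooth_mxT Sg).
  exact: smooth_mxD (smooth_pd_mx i smooth_metric) Sg.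
move=> a b.
apply: smooth_in_ext (smooth_inM (smooth_in_cst c 2^-1) (S a b)) => q cq.
by rewrite connection_mxE // [RHS]mxE.
Qed.

(** Lowered by the metric, the connection matrix is half of [D + L - L^T]; adding its transpose
    cancels the skew part and leaves the symmetric matrix [D]. *)
Lemma metric_compatible i p : dom c p ->
  pd_mx c i (g c) p = Gam i p *m g c p + g c p *m (Gam i p)^T.
Proof.
move=> cp; set D := pd_mx c i (g c) p; set L := grad i p.
have E : Gam i p *m g c p = 2^-1 *: (D + L - L^T).
  by rewrite connection_mxE // -scalemxAl mulmxKV // metric_unit.
have DT : D^T = D.
  rewrite -pd_mxT //; apply: pd_mx_ext => // q cq; exact: metric_mx_sym.
rewrite -[X in _ + X](trmxK) trmx_mul trmxK metric_mx_sym // E linearZ /=.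
rewrite -scalerDr !(trmxD, trmxN) trmxK DT.
apply/matrixP => a b; rewrite !mxE; by field.
Qed.

Lemma pd_inv_metric i p : dom c p ->
  pd_mx c i H p = - (H p *m Gam i p + (Gam i p)^T *m H p).
Proof.
move=> cp; rewrite (pd_invmx i metric_unit smooth_metric cp).
rewrite -/(inv_metric g c p) metric_compatible // mulmxDr mulmxDl.
rewrite !mulmxA mulVmx ?metric_unit // mul1mx -mulmxA.
by rewrite -!mulmxA mulmxV ?metric_unit // mulmx1.
Qed.

Lemma curvature_mxE i j p : dom c p ->
  Curv i j p = pd_mx c i (Gam j) p - pd_mx c j (Gam i) p
    + (Gam j p *m Gam i p - Gam i p *m Gam j p).
Proof.
move=> cp; apply/matrixP => k l; rewrite !mxE /curvature_op sumrB.
congr (_ + _); congr (_ - _).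
- by apply: pd_ext => // q _; rewrite mxE.
- by apply: pd_ext => // q _; rewrite mxE.
- by apply: eq_bigr => s _; rewrite !mxE.
- by apply: eq_bigr => s _; rewrite !mxE.
Qed.

Lemma smooth_curvature_mx i j : smooth_mx c (Curv i j).
Proof.
have S := smooth_connection.
apply: (smooth_mx_ext (fun p cp => esym (curvature_mxE i j cp))).
apply: smooth_mxD; apply: smooth_mxB; try exact: smooth_mxM;
  exact: smooth_pd_mx.
Qed.

Lemma riemannE p i j k l : riemann g c p i j k l = (Curv i j p *m g c p) k l.
Proof. by rewrite mxE; apply: eq_bigr => s _; rewrite mxE. Qed.

Lemma smooth_riemann i j k l : smooth_in c (fun q => riemann g c q i j k l).
Proof.
apply: smooth_in_ext
  (smooth_mxM (smooth_curvature_mx i j) smooth_metric k l) => q _.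
by rewrite riemannE.
Qed.

Lemma riemann_skew12 p i j k l : dom c p ->
  riemann g c p i j k l = - riemann g c p j i k l.
Proof.
move=> cp; rewrite !riemannE -mxNE -mulNmx !curvature_mxE //.
by rewrite opprD !opprB.
Qed.

(** Second partial derivatives of the metric commute. Expanded by metric compatibility, this says
    that the lowered curvature matrix plus its transpose is zero. *)
Lemma riemann_skew34 p i j k l : dom c p ->
  riemann g c p i j k l = - riemann g c p i j l k.
Proof.
move=> cp; rewrite !riemannE; apply/eqP; rewrite -addr_eq0.
have S := smooth_connection; have Sg := smooth_metric.
have pd2 a b : pd_mx c a (pd_mx c b (g c)) p =
    pd_mx c a (Gam b) p *m g c p
    + Gam b p *m (Gam a p *m g c p + g c p *m (Gam a p)^T)
    + ((Gam a p *m g c p + g c p *m (Gam a p)^T) *m (Gam b p)^T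
       + g c p *m (pd_mx c a (Gam b) p)^T).
  have ST := smooth_mxT (S b).
  rewrite (pd_mx_ext a (metric_compatible b) cp).
  rewrite pd_mxD //; try exact: smooth_mxM.
  by rewrite !pd_mxM // pd_mxT // metric_compatible.
have := pd_mx_comm i j Sg cp; move/eqP; rewrite -subr_eq0 !pd2.
rewrite curvature_metric_identity -curvature_mxE // => /eqP/matrixP/(_ k l).
have -> : g c p *m (Curv i j p)^T = (Curv i j p *m g c p)^T.
  by rewrite trmx_mul metric_mx_sym.
by rewrite mxDE [X in _ + X]mxE [RHS]mxE => ->.
Qed.

(** The two products are the connection terms of the first and of the second covariant slot. *)
Definition cov_deriv2 i (F : M -> 'M[R]_n.+1) p : 'M[R]_n.+1 :=
  pd_mx c i F p - Gam i p *m F p - F p *m (Gam i p)^T.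

Lemma cov_deriv2_ext i (F G : M -> 'M[R]_n.+1) p :
  (forall q, dom c q -> F q = G q) -> dom c p ->
  cov_deriv2 i F p = cov_deriv2 i G p.
Proof. by move=> FG cp; rewrite /cov_deriv2 (pd_mx_ext i FG cp) FG. Qed.

Lemma cov_deriv2D i (F G : M -> 'M[R]_n.+1) p :
  smooth_mx c F -> smooth_mx c G -> dom c p ->
  cov_deriv2 i (fun q => F q + G q) p = cov_deriv2 i F p + cov_deriv2 i G p.
Proof.
move=> SF SG cp; rewrite /cov_deriv2 pd_mxD // mulmxDr mulmxDl !opprD.
apply/matrixP => a b; rewrite !(mxDE, mxNE); ring.
Qed.

Lemma cov_deriv2_scale_metric i (f : M -> R) p : smooth_in c f -> dom c p ->
  cov_deriv2 i (fun q => f q *: g c q) p = pd c i f p *: g c p.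
Proof.
move=> Sf cp; rewrite /cov_deriv2.
have -> : pd_mx c i (fun q => f q *: g c q) p =
    pd c i f p *: g c p + f p *: pd_mx c i (g c) p.
  apply/matrixP => a b; rewrite !mxE -pdM //; last exact: smooth_metric.
  by apply: pd_ext => // q _; rewrite mxE.
rewrite metric_compatible // -scalemxAl -scalemxAr scalerDr.
apply/matrixP => a b; rewrite !(mxDE, mxNE); ring.
Qed.

Lemma cov_deriv2Z i a (F : M -> 'M[R]_n.+1) p :
  smooth_mx c F -> dom c p ->
  cov_deriv2 i (fun q => a *: F q) p = a *: cov_deriv2 i F p.
Proof.
move=> SF cp; rewrite /cov_deriv2 -scalemxAl -scalemxAr !scalerBr.
congr (_ - _ - _); apply/matrixP => k l; rewrite !mxE -pdZ //.
by apply: pd_ext => // q _; rewrite mxE.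
Qed.

(** Traces commute with the covariant derivative because the inverse metric is parallel. *)
Lemma pd_trace2 i (F : M -> 'M[R]_n.+1) p : smooth_mx c F -> dom c p ->
  pd c i (fun q => trace2 g c q (F q)) p = trace2 g c p (cov_deriv2 i F p).
Proof.
move=> SF cp; have SH := smooth_inv_metric; have SFT := smooth_mxT SF.
have -> : pd c i (fun q => trace2 g c q (F q)) p
    = \tr (pd_mx c i (fun q => H q *m (F q)^T) p).
  rewrite /mxtrace; under [RHS]eq_bigr do rewrite mxE.
  rewrite -pd_sum // => [|k]; last exact: smooth_mxM.
  by apply: pd_ext => // q _; rewrite trace2E.
rewrite pd_mxM // pd_mxT // pd_inv_metric // /cov_deriv2 trace2E.
rewrite !(trmxD, trmxN, trmx_mul) trmxK.
have tN (B : 'M[R]_n.+1) : \tr (- B) = - \tr B by exact: linearN.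
rewrite !(mulmxDl, mulmxDr, mulNmx, mulmxN, opprD, mxtraceD, tN, mulmxA).
(* Cyclicity matches the only pair of terms that differ in order; one term from the derivative of
   [H] cancels literally. *)
have -> : \tr ((Gam i p)^T *m H p *m (F p)^T)
    = \tr (H p *m (F p)^T *m (Gam i p)^T).
  by rewrite [RHS]mxtrace_mulC mulmxA.
ring.
Qed.

End LeviCivita.

(** * The second Bianchi identity *)

Section Bianchi.

Context (R : realType) (n : nat) (M : topologicalType)
  (A : smooth_manifold R n.+1 M) (g : lorentz_metric A) (c : chart A).
Implicit Types (p q : M) (i j k l m s : 'I_n.+1)
  (Q : M -> 'I_n.+1 -> 'I_n.+1 -> 'I_n.+1 -> 'I_n.+1 -> R).

Local Notation H := (inv_metric g c).
Local Notation Gam := (connection_mx g c).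
Local Notation Curv := (curvature_mx g c).
Local Notation nabla2 := (cov_deriv2 g c).
Local Notation nabla4 := (cov_deriv4 g c).
Local Notation tr2 := (trace2 g c).

(** With [i] and [j] frozen, the last two slots form a matrix and obey [cov_deriv2]; the terms of
    the first two slots mix different matrices and stay a sum. *)
Lemma cov_deriv4E Q p m i j k l (F : M -> 'M[R]_n.+1) :
  (forall q, dom c q -> F q = \matrix_(a, b) Q q i j a b) -> dom c p ->
  nabla4 Q p m i j k l = nabla2 m F p k l
    - \sum_s (Gam m p i s * Q p s j k l + Gam m p j s * Q p i s k l).
Proof.
move=> FE cp; rewrite /cov_deriv2 !mxDE !mxNE -!addrA /cov_deriv4.
congr (_ + _).
  by rewrite mxE; apply: pd_ext => // q cq; rewrite FE // mxE.
rewrite -!opprD; congr (- _).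
rewrite -!mulmx_mxE -!big_split /=; apply: eq_bigr => s _.
rewrite FE // !mxE; ring.
Qed.

(** Lowering an index commutes with the covariant derivative, so the matrix part is that of the
    endomorphism-valued curvature, with a commutator as connection term. *)
Lemma cov_deriv4_riemann p m i j k l : dom c p ->
  nabla4 (riemann g c) p m i j k l =
  ((pd_mx c m (Curv i j) p + Curv i j p *m Gam m p - Gam m p *m Curv i j p)
    *m g c p) k l
  - \sum_s (Gam m p i s * riemann g c p s j k l
            + Gam m p j s * riemann g c p i s k l).
Proof.
move=> cp; rewrite (@cov_deriv4E _ _ _ _ _ _ _ (fun q => Curv i j q *m g c q)) //.
  congr (_ - _); congr (fun_of_matrix _ k l).
  rewrite /cov_deriv2 pd_mxM //; [|exact: smooth_curvature_mx|exact: smooth_metric].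
  rewrite metric_compatible // !mulmxDl mulNmx mulmxDr !mulmxA.
  by apply/matrixP => a b; rewrite !(mxDE, mxNE); ring.
by move=> q _; apply/matrixP => a b; rewrite [RHS]mxE riemannE.
Qed.

(** Two separate cancellations: the matrix parts cancel for any connection by
    [bianchi_matrix_identity], and the terms of the first two slots cancel because the connection is
    torsion-free and the curvature is skew in those slots. *)
Lemma second_bianchi p m i j k l : dom c p ->
  nabla4 (riemann g c) p m i j k l + nabla4 (riemann g c) p i j m k l
  + nabla4 (riemann g c) p j m i k l = 0.
Proof.
move=> cp; rewrite !cov_deriv4_riemann //.
set a := (X in X - _ + _ + _); set b := (X in _ + (X - _) + _).
set d := (X in _ - _ + (_ - _) + (X - _)).
have e : a + b + d = 0.
  rewrite /a /b /d -!mxDE -!mulmxDl.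
  have SC := smooth_connection g c.
  have pC x y z : pd_mx c x (Curv y z) p =
      pd_mx c x (pd_mx c y (Gam z)) p - pd_mx c x (pd_mx c z (Gam y)) p
      + (pd_mx c x (Gam z) p *m Gam y p + Gam z p *m pd_mx c x (Gam y) p
         - (pd_mx c x (Gam y) p *m Gam z p + Gam y p *m pd_mx c x (Gam z) p)).
    rewrite (pd_mx_ext x (fun q cq => curvature_mxE g y z cq) cp).
    have SM u v := smooth_mxM (SC u) (SC v).
    have SP u v := smooth_pd_mx u (SC v).
    rewrite pd_mxD //; [|exact: smooth_mxB|exact: smooth_mxB].
    by rewrite !pd_mxB // !pd_mxM.
  have E x y := curvature_mxE g x y cp.
  have CC x y z := pd_mx_comm x y (SC z) cp.
  have -> := bianchi_matrix_identity (E i j) (E j m) (E m i)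
    (pC m i j) (pC i j m) (pC j m i) (CC i j m) (CC i m j) (CC j m i).
  by rewrite mul0mx mxE.
move: a b d e => a b d e.
(* Since the matrix parts [a], [b], [d] already sum to zero, only the three slot corrections
   remain. *)
have subsum (x y z : R) : x + y + z = 0 -> a - x + (b - y) + (d - z) = 0.
  by move=> xyz; rewrite -[RHS](subrr 0) -{1}e -xyz; ring.
apply: subsum; rewrite -!big_split big1 // => s _ /=.
(* Symmetric lower indices of the Christoffel symbols pair the six terms; skewness gives each pair
   opposite signs. *)
rewrite (connection_mxC g i m s cp) (connection_mxC g j m s cp).
rewrite (connection_mxC g j i s cp) (riemann_skew12 g s j k l cp).
rewrite (riemann_skew12 g s i k l cp) (riemann_skew12 g s m k l cp).
by move: (riemann _ _ _ j _ _ _) (riemann _ _ _ i _ _ _) (riemann _ _ _ m _ _ _);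
  move=> x y z; ring.
Qed.

(** The connection terms of the contracted outer slots are absorbed by [pd_trace2]; those of the
    free slots are combinations of the matrices [F s k] and [F j s], and the trace is linear. *)
Lemma cov_deriv4_contract Q p m j k :
  (forall a b d e, smooth_in c (fun q => Q q a b d e)) -> dom c p ->
  tr2 p (\matrix_(i, l) nabla4 Q p m i j k l)
  = nabla2 m (fun q => \matrix_(j, k) tr2 q (\matrix_(i, l) Q q i j k l)) p j k.
Proof.
move=> SQ cp.
pose F a b q : 'M[R]_n.+1 := \matrix_(i, l) Q q i a b l.
have SF a b : smooth_mx c (F a b).
  by move=> i l; apply: smooth_in_ext (SQ i a b l) => q _; rewrite mxE.
have -> : \matrix_(i, l) nabla4 Q p m i j k l = nabla2 m (F j k) p
    - \sum_s (Gam m p j s *: F s k p + Gam m p k s *: F j s p).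
  apply/matrixP => i l; rewrite mxE mxDE mxNE summxE /cov_deriv2 !mxDE !mxNE.
  rewrite [pd_mx _ _ _ _ _ _]mxE -!addrA; congr (_ + _).
    by apply: pd_ext => // q _; rewrite mxE.
  rewrite -!opprD; congr (- _).
  rewrite -!mulmx_mxE -!big_split /=; apply: eq_bigr => s _.
  rewrite !mxE; ring.
rewrite trace2D trace2N -pd_trace2 // trace2_sum /cov_deriv2 !mxDE !mxNE.
rewrite [pd_mx _ _ _ _ _ _]mxE -!addrA; congr (_ + _).
  by apply: pd_ext => // q _; rewrite mxE.
rewrite -opprD; congr (- _).
rewrite -!mulmx_mxE -!big_split /=; apply: eq_bigr => s _.
by rewrite trace2D !trace2Z !mxE [X in _ + X]mulrC.
Qed.

End Bianchi.

(** * Contractions *)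

Section Contraction.

Context (R : realType) (n : nat) (M : topologicalType)
  (A : smooth_manifold R n.+1 M) (g : lorentz_metric A) (c : chart A).
Implicit Types (p q : M) (i j k l m s : 'I_n.+1)
  (Q : M -> 'I_n.+1 -> 'I_n.+1 -> 'I_n.+1 -> 'I_n.+1 -> R).

Local Notation H := (inv_metric g c).
Local Notation nabla2 := (cov_deriv2 g c).
Local Notation nabla4 := (cov_deriv4 g c).
Local Notation tr2 := (trace2 g c).

Lemma trace2_sumE p (F : 'I_n.+1 -> 'I_n.+1 -> R) :
  tr2 p (\matrix_(i, j) F i j) = \sum_i \sum_j H p i j * F i j.
Proof. by apply: eq_bigr => i _; apply: eq_bigr => j _; rewrite mxE. Qed.

Lemma trace2_exchange p (F : 'I_n.+1 -> 'I_n.+1 -> 'I_n.+1 -> 'I_n.+1 -> R) :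
  tr2 p (\matrix_(i, j) tr2 p (\matrix_(k, l) F i j k l))
  = tr2 p (\matrix_(k, l) tr2 p (\matrix_(i, j) F i j k l)).
Proof.
rewrite !trace2_sumE !pair_bigA /=.
under eq_bigr do rewrite trace2_sumE pair_bigA mulr_sumr.
under [RHS]eq_bigr do rewrite trace2_sumE pair_bigA mulr_sumr.
rewrite exchange_big; apply: eq_bigr => a _; apply: eq_bigr => b _.
by rewrite mulrCA.
Qed.

(** Exchanging slots within each pair turns the middle slots into the outer ones, where
    [cov_deriv4_contract] applies. *)
Lemma cov_deriv4_swap Q p m i j k l :
  nabla4 Q p m i j k l = nabla4 (fun q a b d e => Q q b a e d) p m j i l k.
Proof.
rewrite /cov_deriv4; congr (_ - _); apply: eq_bigr => s _.
by rewrite (addrC (_ * Q p s j k l)) -!addrA; congr (_ + (_ + _)); rewrite addrC.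
Qed.

Lemma div4_contract Q p i :
  (forall a b d e, smooth_in c (fun q => Q q a b d e)) -> dom c p ->
  tr2 p (\matrix_(j, k) div4 g c Q p i j k)
  = tr2 p (\matrix_(m, l) nabla2 m
      (fun q => \matrix_(i, l) tr2 q (\matrix_(j, k) Q q i j k l)) p i l).
Proof.
move=> SQ cp; rewrite trace2_exchange; congr (tr2 p _).
apply/matrixP => m l; rewrite [LHS]mxE [RHS]mxE.
rewrite -[RHS](@cov_deriv4_contract _ _ _ _ g c (fun q a b d e => Q q b a e d)) //.
by congr (tr2 p _); apply/matrixP => j k; rewrite !mxE -cov_deriv4_swap.
Qed.

Lemma smooth_ricci : smooth_mx c (ricci g c).
Proof.
move=> j k.
have S : smooth_mx c (fun q => \matrix_(i, l) riemann g c q i j k l).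
  move=> i l; apply: smooth_in_ext (smooth_riemann g c i j k l) => q _.
  by rewrite mxE.
by apply: smooth_in_ext (smooth_trace2 g S) => q _; rewrite [RHS]mxE.
Qed.

Lemma smooth_scalar_curvature : smooth_in c (scalar_curvature g c).
Proof. by have S := smooth_trace2 g smooth_ricci; exact: S. Qed.

(** The two skew symmetries give [R_ijkl = R_jilk], so the middle trace is the outer trace defining
    [ricci], with the same sign. *)
Lemma riemann_contract23 q i l : dom c q ->
  tr2 q (\matrix_(j, k) riemann g c q i j k l) = ricci g c q i l.
Proof.
move=> cq; rewrite [RHS]mxE; congr (tr2 q _); apply/matrixP => j k.
rewrite [LHS]mxE [RHS]mxE (riemann_skew12 g i j k l cq).
by rewrite (riemann_skew34 g j i k l cq) opprK.
Qed.

Lemma cov_deriv4_riemann_skew12 p m i j k l : dom c p ->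
  nabla4 (riemann g c) p m i j k l = - nabla4 (riemann g c) p m j i k l.
Proof.
move=> cp; rewrite /cov_deriv4 opprD opprK.
have neg_sum4 (x y z w a b d e : R) :
    - (x * - a + y * - b + z * - d + w * - e) = y * b + x * a + z * d + w * e.
  ring.
congr (_ + _).
  rewrite -pdN //; last exact: smooth_riemann.
  by apply: pd_ext => // q cq; apply: riemann_skew12.
rewrite -sumrN; apply: eq_bigr => s _.
rewrite (riemann_skew12 g s j k l cp) (riemann_skew12 g i s k l cp).
rewrite (riemann_skew12 g i j s l cp) (riemann_skew12 g i j k s cp).
exact: neg_sum4.
Qed.

(** The Bianchi identity is traced twice. The factor 2 arises because both terms on the right of [B]
    have the same trace, the divergence of the Ricci tensor. *)
Lemma contracted_bianchi p m : dom c p ->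
  pd c m (scalar_curvature g c) p
  = 2 * tr2 p (\matrix_(j, k) nabla2 j (ricci g c) p m k).
Proof.
move=> cp.
have SR a b d e : smooth_in c (fun q => riemann g c q a b d e).
  exact: smooth_riemann.
have contr a j k : tr2 p (\matrix_(i, l) nabla4 (riemann g c) p a i j k l)
    = nabla2 a (ricci g c) p j k by rewrite cov_deriv4_contract.
have div_ricci : tr2 p (\matrix_(j, k) div4 g c (riemann g c) p m j k)
    = tr2 p (\matrix_(j, k) nabla2 j (ricci g c) p m k).
  rewrite div4_contract //; congr (tr2 p _); apply/matrixP => j k.
  rewrite [LHS]mxE [RHS]mxE; congr (fun_of_matrix _ m k).
  apply: cov_deriv2_ext => // q cq; apply/matrixP => i l.
  by rewrite mxE riemann_contract23.
(* This is the Bianchi identity traced over [i] and [l], with two of its terms moved across by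
   skewness in the first two slots. *)
have B j k : nabla2 m (ricci g c) p j k
    = nabla2 j (ricci g c) p m k + div4 g c (riemann g c) p m j k.
  apply: etrans (esym (contr m j k)) _.
  apply: etrans _ (congr1 (+%R^~ _) (contr j m k)).
  rewrite /div4 -trace2D; congr (tr2 p _).
  apply/matrixP => i l; rewrite [RHS]mxDE [LHS]mxE [X in _ = X + _]mxE.
  rewrite [X in _ = _ + X]mxE; have := second_bianchi g m i j k l cp.
  rewrite (cov_deriv4_riemann_skew12 i j m k l cp).
  rewrite (cov_deriv4_riemann_skew12 j m i k l cp) => /eqP.
  by rewrite subr_eq0 subr_eq => /eqP.
rewrite pd_trace2 //; last exact: smooth_ricci.
rewrite mulr2n mulrDl !mul1r -{2}div_ricci -trace2D; congr (tr2 p _).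
apply/matrixP => j k; apply: etrans (B j k) _; rewrite [RHS]mxDE.
by rewrite [X in _ = X + _]mxE [X in _ = _ + X]mxE.
Qed.

Lemma trace2_metric_row p i (Y : 'M[R]_n.+1) l : dom c p ->
  tr2 p (\matrix_(j, k) (g c p i k * Y j l)) = Y i l.
Proof.
move=> cp; rewrite trace2_sumE -[in RHS](mul1mx Y).
rewrite -(mulmxV (metric_unit g cp)) -mulmxA -/(inv_metric g c p).
rewrite mxE; under [RHS]eq_bigr do rewrite mxE mulr_sumr.
rewrite exchange_big; apply: eq_bigr => j _; apply: eq_bigr => k _.
by rewrite (inv_metricC g k j cp) mulrCA.
Qed.

Lemma trace2_metric_col p i (Y : 'M[R]_n.+1) l : dom c p ->
  tr2 p (\matrix_(j, k) (g c p j l * Y i k)) = Y i l.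
Proof.
move=> cp; have -> : Y i l = Y^T l i by rewrite mxE.
rewrite -trace2T // -(trace2_metric_row l Y^T i cp).
by congr (tr2 p _); apply/matrixP => j k; rewrite !mxE (metricC g k l cp).
Qed.

Lemma wedge_contract23 p (X : 'M[R]_n.+1) i l : dom c p ->
  tr2 p (\matrix_(j, k) wedge (g c p) X i j k l)
  = n.+1%:R * X i l + tr2 p X * g c p i l - X i l - X i l.
Proof.
move=> cp.
have -> : \matrix_(j, k) wedge (g c p) X i j k l =
    X i l *: g c p + g c p i l *: X - \matrix_(j, k) (g c p i k * X j l)
    - \matrix_(j, k) (g c p j l * X i k).
  by apply/matrixP => j k; rewrite !mxE /wedge; ring.
rewrite !(trace2D, trace2N, trace2Z) trace2_metric // trace2_metric_row //.
by rewrite trace2_metric_col // (mulrC (X i l)) (mulrC (tr2 p X)).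
Qed.

Lemma wedge_metric p i j k l :
  wedge (g c p) (g c p) i j k l = 2 * Gtensor g c p i j k l.
Proof. by rewrite /wedge /Gtensor; ring. Qed.

End Contraction.

(** * Vanishing of the differential of the energy density *)

Section EnergyDensity.

Context (R : realType) (M : topologicalType) (A : smooth_manifold R 4 M)
  (g : lorentz_metric A) (Lambda kappa : R) (T : tensor2 A) (sigma : M -> R)
  (Ssigma : smooth_scalar A sigma)
  (einstein : einstein_equation g Lambda kappa T)
  (divP : space_matter_div_free g kappa T sigma).

Lemma space_matter_contract23 (c : chart A) q i l : dom c q ->
  trace2 g c q (\matrix_(j, k) space_matter g kappa T sigma c q i j k l)
  = 2 * ricci g c q i l
    + (3 * Lambda - scalar_curvature g c q - 3 * sigma q) * g c q i l.
Proof.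
move=> cq; set r := scalar_curvature g c q.
(* Moving [kappa] inside the wedge lets Einstein's equation replace [kappa *: T] as a whole, without
   division by [kappa]; writing [G] as half of [wedge g g] lets one contraction formula serve both
   terms. *)
have -> : \matrix_(j, k) space_matter g kappa T sigma c q i j k l
    = \matrix_(j, k) riemann g c q i j k l
      + 2^-1 *: \matrix_(j, k) wedge (g c q) (kappa *: T c q) i j k l
      - (sigma q / 2) *: \matrix_(j, k) wedge (g c q) (g c q) i j k l.
  apply/matrixP => j k; rewrite !mxE wedge_metric /space_matter.
  by congr (_ + _ - _); [rewrite /wedge !mxE; field|field].
rewrite !(trace2D, trace2N, trace2Z) riemann_contract23 // !wedge_contract23 //.
rewrite trace2_metric // -einstein //.
rewrite !(trace2D, trace2N, trace2Z) trace2_metric //.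
rewrite -/(scalar_curvature g c q) -/r !mxE; by field.
Qed.

Lemma smooth_space_matter (c : chart A) i j k l :
  smooth_in c (fun q => space_matter g kappa T sigma c q i j k l).
Proof.
have Sg a b : smooth_in c (fun q => g c q a b) by exact: t2_smooth.
have ST a b : smooth_in c (fun q => T c q a b) by exact: t2_smooth.
apply: smooth_inB; last first.
  by apply: smooth_inM; [exact: Ssigma|apply: smooth_inB; apply: smooth_inM].
apply: smooth_inD; first exact: smooth_riemann.
apply: smooth_inM; first exact: smooth_in_cst.
by apply: smooth_inB; [apply: smooth_inB; [apply: smooth_inD|]|]; apply: smooth_inM.
Qed.

Lemma pd_energy_density (c : chart A) p i : dom c p -> pd c i sigma p = 0.
Proof.
move=> cp; have Sr := smooth_scalar_curvature g c.
pose f q := 3 * Lambda - scalar_curvature g c q - 3 * sigma q.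
have S3 : smooth_in c (fun q => 3 * sigma q).
  exact: smooth_inM (smooth_in_cst c 3) (Ssigma c).
have SL : smooth_in c (fun q => 3 * Lambda - scalar_curvature g c q).
  exact: smooth_inB (smooth_in_cst c _) Sr.
have Sf : smooth_in c f by exact: smooth_inB SL S3.
have SS : smooth_mx c (fun q => 2 *: ricci g c q).
  move=> a b; apply: smooth_in_ext
    (smooth_inM (smooth_in_cst c 2) (smooth_ricci g c a b)) => q _.
  by rewrite [RHS]mxE.
have Sfg : smooth_mx c (fun q => f q *: g c q).
  move=> a b; apply: smooth_in_ext (smooth_inM Sf (smooth_metric g c a b)) => q _.
  by rewrite [RHS]mxE.
(* All columns of [Y] are the gradient of [f]; the matrix shape fits [trace2_metric_row], and only
   column 0 is read. *)
pose Y : 'M[R]_4 := \matrix_(m, _) pd c m f p.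
have := div4_contract g i (smooth_space_matter c) cp.
have -> : \matrix_(j, k) div4 g c (space_matter g kappa T sigma c) p i j k = 0.
  by apply/matrixP => j k; rewrite [LHS]mxE [RHS]mxE divP.
have -> : \matrix_(m, l) cov_deriv2 g c m (fun q => \matrix_(a, b)
      trace2 g c q (\matrix_(j, k) space_matter g kappa T sigma c q a j k b)) p i l
    = 2 *: \matrix_(m, l) cov_deriv2 g c m (ricci g c) p i l
      + \matrix_(m, l) (g c p i l * Y m 0).
  apply/matrixP => m l; rewrite [LHS]mxE [RHS]mxDE [X in _ = X + _]mxE.
  rewrite [X in _ = _ * X + _]mxE [X in _ = _ + X]mxE [Y m 0]mxE.
  rewrite (@cov_deriv2_ext _ _ _ _ g c m _
    (fun q => 2 *: ricci g c q + f q *: g c q) p _ cp); last first.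
    by move=> q cq; apply/matrixP => a b; rewrite [LHS]mxE
      space_matter_contract23 // [RHS]mxDE [X in _ = X + _]mxE
      [X in _ = _ + X]mxE.
  rewrite cov_deriv2D // cov_deriv2Z //; last exact: smooth_ricci.
  rewrite cov_deriv2_scale_metric // mxDE.
  by rewrite [X in X + _ = _]mxE [X in _ + X = _]mxE [X in _ + X = _]mulrC.
rewrite trace2D trace2Z -contracted_bianchi // trace2_metric_row // mxE.
rewrite trace2_0 /f.
rewrite (pdB i SL S3 cp) (pdB i (smooth_in_cst c _) Sr cp) pd_cst.
rewrite (pdZ 3 i (Ssigma c) cp).
by move=> e; lra.
Qed.

End EnergyDensity.

(** * From vanishing derivatives to constancy *)

Section LocallyConstant.

Context (R : realType).

Lemma constant_line (V : normedModType R) (f : V -> R) w v (a : R) : 0 <= a ->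
  (forall s, 0 <= s <= a ->
    derivable f (w + s *: v) v /\ 'D_v f (w + s *: v) = 0) ->
  f (w + a *: v) = f w.
Proof.
rewrite le_eqVlt => /orP[/eqP<- _|a0 H]; first by rewrite scale0r addr0.
have [|s /andP[s0 sa] e] := @mean_value_line R V f w v a a0.
  by move=> s sa; exact: (H s sa).1.
have [_ d0] : derivable f (w + s *: v) v /\ 'D_v f (w + s *: v) = 0.
  by apply: H; rewrite !ltW.
by move: e; rewrite d0 mulr0 => /eqP; rewrite subr_eq0 => /eqP.
Qed.

(** Balls of row vectors are cubes, so a path changing one coordinate at a time from the centre to
    [y] stays inside. *)
Lemma ball_between n (x y w : 'rV[R]_n) (r : R) : ball x r y ->
  (forall j, `|x 0 j - w 0 j| <= `|x 0 j - y 0 j|) -> ball x r w.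
Proof.
move=> [r0 xy] xw; split=> // i j; rewrite (ord1 i).
exact: le_lt_trans (xw j) (xy 0 j).
Qed.

Lemma ball_partials0_constant n (x : 'rV[R]_n) (r : R) (f : 'rV[R]_n -> R) :
  (forall y, ball x r y -> forall i,
    derivable f y (delta_mx 0 i) /\ partial i f y = 0) ->
  forall y, ball x r y -> f y = f x.
Proof.
move=> H y xy.
(* These are the corners of a path from [x] to [y] along the axes: [z k.+1] and [z k] can differ
   only in coordinate [k]. *)
pose z k : 'rV[R]_n := \row_j (if (j < k)%N then y 0 j else x 0 j).
have zn : z n = y by apply/rowP => j; rewrite mxE ltn_ord.
have z0 : z 0%N = x by apply/rowP => j; rewrite mxE.
suff step k : (k <= n)%N -> f (z k) = f x by rewrite -zn step.
elim: k => [|k IH] kn; first by rewrite z0.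
apply: etrans _ (IH (ltnW kn)); pose i := Ordinal kn.
pose d := y 0 i - x 0 i.
have zE : z k.+1 = z k + d *: delta_mx 0 i.
  apply/rowP => j; rewrite !mxE eqxx /= ltnS leq_eqVlt.
  rewrite -[(j == k :> nat)]/(j == i).
  have [->|ji] := eqVneq j i; first by rewrite ltnn mulr1 /= /d subrKC.
  by rewrite mulr0 addr0.
have zb t : `|t| <= `|d| -> ball x r (z k + t *: delta_mx 0 i).
  move=> td; apply: (ball_between xy) => j; rewrite !mxE eqxx /=.
  have [->|ji] := eqVneq j i.
    by rewrite ltnn mulr1 opprD addNKr normrN distrC.
  by rewrite mulr0 addr0; case: ifP => // _; rewrite subrr normr0.
have Hz t : `|t| <= `|d| -> derivable f (z k + t *: delta_mx 0 i) (delta_mx 0 i)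
    /\ 'D_(delta_mx 0 i) f (z k + t *: delta_mx 0 i) = 0.
  by move=> td; exact: H (zb _ td) i.
have [d0|d0] := leP 0 d.
  rewrite zE; apply: constant_line d0 _ => s /andP[s0 sd]; apply: Hz.
  by rewrite !ger0_norm // (le_trans s0).
(* As [constant_line] takes non-negative lengths, a segment with [d < 0] is run backwards from
   [z k.+1]. *)
have -> : z k = z k.+1 + (- d) *: delta_mx 0 i.
  by rewrite zE scaleNr addrK.
apply/esym; apply: constant_line => [|s /andP[s0 sd]].
  by rewrite oppr_ge0 ltW.
rewrite zE -addrA -scalerDl; apply: Hz.
by rewrite !ler0_norm ?(ltW d0) //; lra.
Qed.

End LocallyConstant.

(** The level set through [q] is non-empty, open and closed. *)
Lemma locally_constant_connected (R : Type) (M : topologicalType) (f : M -> R) :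
  connected [set: M] -> (forall p, \forall q \near p, f q = f p) ->
  forall p q, f p = f q.
Proof.
move=> cM lf p q; have op a : open [set x | f x = a].
  by rewrite openE => x /= <-; apply: lf.
have -> // : [set x | f x = f q] p.
rewrite (cM [set x | f x = f q]) //; first by exists q.
- by exists [set x | f x = f q]; rewrite ?setTI.
exists [set x | f x = f q]; rewrite ?setTI // -openC openE => x /= xq.
by apply: filterS (lf x) => y /= ->.
Qed.

Lemma pd0_locally_constant (R : realType) (n : nat) (M : topologicalType)
    (A : smooth_manifold R n M) (f : M -> R) :
  smooth_scalar A f ->
  (forall (c : chart A) p i, dom c p -> pd c i f p = 0) ->
  forall p, \forall q \near p, f q = f p.
Proof.
move=> Sf df p; have [c cp] := dom_cover A p.
have oU := @image_open _ _ _ A c.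
have /nbhs_ballP[r /= r0 rU] :
    \forall x \near coord c p, (coord c @` dom c) x.
  by apply: open_nbhs_nbhs; split=> //; exact: image_coord.
have cst x : ball (coord c p) r x -> f (param c x) = f p.
  rewrite -{2}(coordK cp).
  apply: (@ball_partials0_constant R n (coord c p) r (f \o param c)) => y /rU Uy i.
  split; first exact: smooth_on_derivable (Sf c) Uy.
  by have := df c _ i (param_dom Uy); rewrite /pd paramK.
have N1 : \forall q \near p, dom c q.
  by apply: open_nbhs_nbhs; split=> //; exact: dom_open.
have N2 : \forall q \near p, ball (coord c p) r (coord c q).
  by apply: (coord_continuous cp); exact: nbhsx_ballx.
by apply: filterS2 N1 N2 => q cq /cst; rewrite coordK.
Qed.

Theorem theorem11p1 (R : realType) (M : topologicalType)
    (A : smooth_manifold R 4 M) (g : lorentz_metric A)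
    (Lambda kappa : R) (T : tensor2 A) (sigma : M -> R) :
  is_CoQE4_spacetime g ->
  smooth_scalar A sigma ->
  einstein_equation g Lambda kappa T ->
  space_matter_div_free g kappa T sigma ->
  exists s0 : R, forall p : M, sigma p = s0.
Proof.
move=> [cM _] Ssigma einstein divP.
have sigma_eq : forall p q, sigma p = sigma q.
  apply: locally_constant_connected cM _; apply: (pd0_locally_constant Ssigma).
  by move=> c p i cp; apply: pd_energy_density einstein divP _ _ _ cp.
(* The constant is read off at a point; with no point at all the claim is vacuous and 0 serves. *)
have [[p _]|M0] := pselect (exists p : M, True).
  by exists (sigma p) => q; exact: sigma_eq.
by exists 0 => p; case: M0; exists p.
Qed.
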